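(* The group $$\langle a,t \mid [a,t,t]=[a,t,a,a,a]=1\rangle$$ is not residually torsion-free nilpotent.
   Context: Commutators: $[x,y]=x^{-1}y^{-1}xy$, and $[a_1,\dots,a_{m+1}]=[[a_1,\dots,a_m],a_{m+1}]$ (left-normed). A group $G$ is residually torsion-free nilpotent if for each $g\in G$, $g\ne 1$, there is a normal subgroup $N$ of $G$ with $g\notin N$ and $G/N$ torsion-free nilpotent. *)

(* Defs.v *)
From HB Require Import structures.
From mathcomp Require Import all_boot.
From mathcomp Require Import generic_quotient boolp classical_sets.

Set Implicit Arguments.
Unset Strict Implicit.
Unset Printing Implicit Defensive.

Local Open Scope group_scope.
Local Open Scope classical_set_scope.

(** * Free groups *)

Section Reduction.
Variable X : choiceType.

(* The letter (x, false) stands for x, and (x, true) for x^-1. *)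
Local Notation letter := (X * bool)%type.

Implicit Types (l : letter) (w : seq letter).

Definition linv l : letter := (l.1, ~~ l.2).

Definition reduced w : bool := sorted (fun k l => l != linv k) w.

Definition push l w : seq letter :=
  if w is k :: w' then if k == linv l then w' else l :: w else [:: l].

Definition reduce w : seq letter := foldr push [::] w.

Lemma linvK : involutive linv.
Proof. by case=> x b; rewrite /linv /= negbK. Qed.

Lemma push_reduced l w : reduced w -> reduced (push l w).
Proof.
rewrite /reduced; case: w => [|k w] //= kw.
case: ifP => [_|/negbT kl /=]; last by rewrite kl.
exact: path_sorted kw.
Qed.

Lemma reduce_reduced w : reduced (reduce w).
Proof. by elim: w => //= l w; exact: push_reduced. Qed.

Lemma reduce_id w : reduced w -> reduce w = w.
Proof.
elim: w => //= l w IHw lw; rewrite IHw; last exact: path_sorted lw.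
by case: w lw {IHw} => //= k w /andP[/negPf ->].
Qed.

Lemma pushK l w : reduced w -> push (linv l) (push l w) = w.
Proof.
case: w => [|k w] /=; first by rewrite linvK eqxx.
case: ifP => [/eqP->|_ _]; last by rewrite /= linvK eqxx.
by case: w => //= k' w /andP[/negPf ->].
Qed.

Lemma foldr_push_push l u v : reduced u -> reduced v ->
  foldr push v (push l u) = push l (foldr push v u).
Proof.
have rf w : reduced v -> reduced (foldr push v w).
  by move=> rv; elim: w => //= k w; exact: push_reduced.
case: u => //= k u ru rv; case: ifP => // /eqP->.
by have := pushK (linv l) (rf u rv); rewrite linvK => ->.
Qed.

Lemma foldr_push_reduce u v : reduced v ->
  foldr push v (reduce u) = foldr push v u.
Proof.
move=> rv; elim: u => //= l u IHu.
by rewrite foldr_push_push ?reduce_reduced// IHu.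
Qed.

Lemma reduce_catl u v : reduce (reduce u ++ v) = reduce (u ++ v).
Proof.
by rewrite /reduce !foldr_cat foldr_push_reduce// reduce_reduced.
Qed.

Lemma reduce_catr u v : reduce (u ++ reduce v) = reduce (u ++ v).
Proof.
by rewrite /reduce !foldr_cat; congr foldr; apply/reduce_id/reduce_reduced.
Qed.

Lemma reduce_invl w : reduce (map linv (rev w) ++ w) = [::].
Proof.
rewrite /reduce foldr_cat -/(reduce w).
elim: w => //= l w IHw.
by rewrite rev_cons map_rcons foldr_rcons pushK ?reduce_reduced.
Qed.

Lemma reduce_invr w : reduce (w ++ map linv (rev w)) = [::].
Proof.
by have := reduce_invl (map linv (rev w)); rewrite -map_rev revK mapK//;
  exact: linvK.
Qed.

End Reduction.

Record freegroup (X : choiceType) : Type := FreeGroup {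
  fgword :> seq (X * bool);
  _ : reduced fgword }.

HB.instance Definition _ (X : choiceType) := [isSub for @fgword X].
HB.instance Definition _ (X : choiceType) := [Choice of freegroup X by <:].

Definition fgreduce (X : choiceType) (w : seq (X * bool)) : freegroup X :=
  FreeGroup (reduce_reduced w).

Section FreeGroupOps.
Variable X : choiceType.
Implicit Types u v w : freegroup X.

Definition fgone : freegroup X := fgreduce [::].
Definition fgmul u v : freegroup X := fgreduce (u ++ v).
Definition fginv u : freegroup X := fgreduce (map (@linv X) (rev u)).

Lemma fgmulA : associative fgmul.
Proof. by move=> u v w; apply: val_inj; rewrite /= reduce_catl reduce_catr catA. Qed.
Lemma fg1mul : left_id fgone fgmul.
Proof. by move=> u; apply: val_inj; rewrite /= reduce_id//; case: u. Qed.
Lemma fgmul1 : right_id fgone fgmul.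
Proof. by move=> u; apply: val_inj; rewrite /= cats0 reduce_id//; case: u. Qed.
Lemma fgVmul : left_inverse fgone fginv fgmul.
Proof. by move=> u; apply: val_inj; rewrite /= reduce_catl reduce_invl. Qed.
Lemma fgmulV : right_inverse fgone fginv fgmul.
Proof. by move=> u; apply: val_inj; rewrite /= reduce_catr reduce_invr. Qed.

HB.instance Definition _ :=
  isGroup.Build (freegroup X) fgmulA fg1mul fgmul1 fgVmul fgmulV.

End FreeGroupOps.

Definition fggen (X : choiceType) (x : X) : freegroup X :=
  fgreduce [:: (x, false)].

(** * Subgroups and quotients *)

Definition subgroup (G : groupType) (H : set G) : Prop := group_closed (mem H).

Definition is_normal (G : groupType) (N : set G) : Prop :=
  subgroup N /\ (forall x y : G, N x -> N (x ^ y)).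

Definition generated_subgroup (G : groupType) (A : set G) : set G :=
  smallest (@subgroup G) A.

Record normal_subgroup (G : groupType) : Type := NormalSubgroup {
  nset :> G -> Prop;
  nsetP : is_normal nset }.

Lemma smallest_is_normal (G : groupType) (A : set G) :
  is_normal (smallest (@is_normal G) A).
Proof.
split; last first.
  by move=> x y Nx M [nM AM]; apply: nM.2; exact: Nx.
split; first by rewrite inE => M [[[+ _] _] _]; rewrite inE.
move=> x y; rewrite !inE => Nx Ny M MA; have [[[_ +] _] _] := MA.
by move=> /(_ x y); rewrite !inE; apply; [exact: Nx | exact: Ny].
Qed.

Definition normal_closure (G : groupType) (A : set G) : normal_subgroup G :=
  NormalSubgroup (smallest_is_normal A).

Section Quotient.
Variables (G : groupType) (N : normal_subgroup G).

Lemma nset1 : N 1.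
Proof. by have [[+ _] _] := nsetP N; rewrite inE. Qed.
Lemma nsetF x y : N x -> N y -> N (x / y).
Proof. by have [[_ +] _] := nsetP N; move=> /(_ x y); rewrite !inE. Qed.
Lemma nsetJ x y : N x -> N (x ^ y).
Proof. by have [_] := nsetP N; apply. Qed.
Lemma nsetV x : N x -> N x^-1.
Proof. by move=> Nx; rewrite -[_^-1]mul1g; apply: nsetF => //; exact: nset1. Qed.
Lemma nsetM x y : N x -> N y -> N (x * y).
Proof. by move=> Nx Ny; rewrite -[y]invgK; apply: nsetF => //; exact: nsetV. Qed.

Definition cosetrel : rel G := fun x y => `[< N (x^-1 * y) >].

Lemma cosetrel_refl : reflexive cosetrel.
Proof. by move=> x; apply/asboolP; rewrite mulVg; exact: nset1. Qed.
Lemma cosetrel_sym : symmetric cosetrel.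
Proof.
by move=> x y; apply/asboolP/asboolP => /nsetV; rewrite invgM invgK.
Qed.
Lemma cosetrel_trans : transitive cosetrel.
Proof.
move=> y x z /asboolP xy /asboolP yz; apply/asboolP.
by have := nsetM xy yz; rewrite -mulgA mulVKg.
Qed.

Canonical cosetrel_equiv :=
  EquivRel cosetrel cosetrel_refl cosetrel_sym cosetrel_trans.

Local Open Scope quotient_scope.

Definition quotient_group : Type := {eq_quot cosetrel}.
HB.instance Definition _ := Choice.on quotient_group.
HB.instance Definition _ := EqQuotient.on quotient_group.

Definition qproj (x : G) : quotient_group := \pi_quotient_group x.

Definition qone : quotient_group := qproj 1.
Definition qmul (u v : quotient_group) : quotient_group := qproj (repr u * repr v).
Definition qinv (u : quotient_group) : quotient_group := qproj (repr u)^-1.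

Lemma qproj_eq x y : (qproj x = qproj y) <-> N (x^-1 * y).
Proof.
split; first by move=> /eqP; rewrite /qproj eqmodE => /asboolP.
by move=> Nxy; apply/eqP; rewrite /qproj eqmodE; exact/asboolP.
Qed.

Lemma qprojK u : qproj (repr u) = u.
Proof. exact: reprK. Qed.

Lemma repr_qproj x : N ((repr (qproj x))^-1 * x).
Proof. by apply/qproj_eq; rewrite qprojK. Qed.

Lemma qprojM x y : qproj (x * y) = qmul (qproj x) (qproj y).
Proof.
apply/esym/qproj_eq.
set x' := repr _; set y' := repr _.
have -> : (x' * y')^-1 * (x * y) = (x'^-1 * x) ^ y' * (y'^-1 * y).
  by rewrite /conjg invgM !mulgA mulgK.
by apply: nsetM; [apply: nsetJ|]; exact: repr_qproj.
Qed.

Lemma qprojV x : qproj x^-1 = qinv (qproj x).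
Proof.
apply/esym/qproj_eq; set x' := repr _.
have -> : x'^-1^-1 * x^-1 = ((x'^-1 * x) ^ x'^-1)^-1.
  by rewrite /conjg !invgK !mulgA mulgV mul1g invgM invgK.
by apply/nsetV/nsetJ/repr_qproj.
Qed.

Lemma qmulA : associative qmul.
Proof.
move=> u v w; rewrite -[u]qprojK -[v]qprojK -[w]qprojK.
by rewrite -!qprojM mulgA.
Qed.
Lemma q1mul : left_id qone qmul.
Proof. by move=> u; rewrite -[u]qprojK -qprojM mul1g. Qed.
Lemma qmul1 : right_id qone qmul.
Proof. by move=> u; rewrite -[u]qprojK -qprojM mulg1. Qed.
Lemma qVmul : left_inverse qone qinv qmul.
Proof. by move=> u; rewrite -[u]qprojK -qprojV -qprojM mulVg. Qed.
Lemma qmulV : right_inverse qone qinv qmul.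
Proof. by move=> u; rewrite -[u]qprojK -qprojV -qprojM mulgV. Qed.

HB.instance Definition _ := isGroup.Build quotient_group qmulA q1mul qmul1 qVmul qmulV.

End Quotient.

(* The group < X | r = 1 for r in R >. *)
Definition presented (X : choiceType) (R : set (freegroup X)) : groupType :=
  quotient_group (normal_closure R).

(** * Residual torsion-free nilpotence *)

Definition torsion_free (G : groupType) : Prop :=
  forall (x : G) (n : nat), (0 < n)%N -> x ^+ n = 1 -> x = 1.

(* lower_central G n is usually written gamma_(n+1)(G). *)
Fixpoint lower_central (G : groupType) (n : nat) : set G :=
  if n is n'.+1 then
    generated_subgroup [set z | exists x y : G, lower_central n' x /\ z = [~ x, y]]
  else setT.
Arguments lower_central : clear implicits.

Definition is_nilpotent (G : groupType) : Prop :=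
  exists n : nat, lower_central G n = [set 1].

Definition residually_torsion_free_nilpotent (G : groupType) : Prop :=
  forall g : G, g <> 1 ->
    exists N : normal_subgroup G,
      [/\ ~ N g, torsion_free (quotient_group N) & is_nilpotent (quotient_group N)].

(* Main.v *)
(* Put b = [a,t]. Since a^t = a b and b^t = b, conjugating the second relation
   by powers of t gives [b, a b^i, a b^i, a b^i] = 1 for all integers i. Let H be
   the subgroup generated by a and b. Modulo gamma_5(H) these commutators expand
   multilinearly; the cases i = 0, 1, -1 and the Jacobi identity
   [b,a,a,b] = [b,a,b,a] show that gamma_4(H)/gamma_5(H) is killed by 4, and then
   so is every later factor gamma_k(H)/gamma_(k+1)(H). Hence gamma_4(H) is trivial
   in every torsion-free nilpotent quotient, and [b,a,a,b] dies there. It is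
   nontrivial in the group itself, as a permutation representation on 64 points
   shows. *)

Require Import Defs.
From HB Require Import structures.
From mathcomp Require Import all_boot perm.
From mathcomp Require Import boolp classical_sets.
Local Open Scope group_scope.
Local Open Scope classical_set_scope.

Set Implicit Arguments.
Unset Strict Implicit.
Unset Printing Implicit Defensive.

(** * Subgroups, generated subgroups and homomorphisms *)

Lemma subgroupP (G : groupType) (H : set G) :
  subgroup H <-> H 1 /\ (forall x y, H x -> H y -> H (x / y)).
Proof.
by split=> -[H1 HF]; (split=> [|x y]; [move: H1 | move: (HF x y)]); rewrite !inE.
Qed.

Section Subgroup.
Variables (G : groupType) (H : set G).
Hypothesis sH : subgroup H.

Lemma subgroup1 : H 1.
Proof. by case/subgroupP: sH. Qed.
Lemma subgroupF x y : H x -> H y -> H (x / y).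
Proof. by case/subgroupP: sH => _; apply. Qed.
Lemma subgroupV x : H x -> H x^-1.
Proof. by move=> Hx; rewrite -div1g; apply: subgroupF => //; exact: subgroup1. Qed.
Lemma subgroupM x y : H x -> H y -> H (x * y).
Proof. by move=> Hx Hy; rewrite -[y]invgK; apply/subgroupF/subgroupV. Qed.
End Subgroup.

Lemma generated_subgroup_subgroup (G : groupType) (A : set G) :
  subgroup (generated_subgroup A).
Proof.
apply/subgroupP; split=> [M [sM _]|x y Ax Ay M MA]; first exact: subgroup1.
by have [sM _] := MA; apply: subgroupF => //; [apply: Ax | apply: Ay].
Qed.

Lemma generated_subgroup_min (G : groupType) (A M : set G) :
  subgroup M -> A `<=` M -> generated_subgroup A `<=` M.
Proof. by move=> sM AM x; apply. Qed.

Lemma sub_generated_subgroup (G : groupType) (A : set G) :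
  A `<=` generated_subgroup A.
Proof. by move=> x Ax M [_]; apply. Qed.

Lemma subgroup_preimage (G H : groupType) (f : UMagmaMorphism.type G H)
  (M : set H) : subgroup M -> subgroup (f @^-1` M).
Proof.
move=> sM; apply/subgroupP; split=> [|x y Mx My] /=.
  by rewrite gmulf1; exact: subgroup1.
by rewrite gmulfF; exact: subgroupF.
Qed.

Lemma subgroup_image (G H : groupType) (f : UMagmaMorphism.type G H)
  (M : set G) : subgroup M -> subgroup (f @` M).
Proof.
move=> sM; apply/subgroupP; split.
  by exists 1; [exact: subgroup1 | rewrite gmulf1].
by move=> _ _ [x Mx <-] [y My <-]; exists (x / y); [exact: subgroupF | rewrite gmulfF].
Qed.

(** * Commutator identities *)

Lemma commgMl (G : groupType) (x y z : G) : [~ x * y, z] = [~ x, z] ^ y * [~ y, z].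
Proof. by rewrite /commg /conjg !gnorm. Qed.

Lemma commgMr (G : groupType) (x y z : G) : [~ x, y * z] = [~ x, z] * [~ x, y] ^ z.
Proof. by rewrite /commg /conjg !gnorm. Qed.

Lemma commgVl (G : groupType) (x y : G) : [~ x^-1, y] = ([~ x, y]^-1) ^ x^-1.
Proof. by rewrite /commg /conjg !gnorm. Qed.

Lemma commgVr (G : groupType) (x y : G) : [~ x, y^-1] = ([~ x, y]^-1) ^ y^-1.
Proof. by rewrite /commg /conjg !gnorm. Qed.

Lemma conjg_mulR (G : groupType) (x y : G) : x ^ y = x * [~ x, y].
Proof. by rewrite commgEl mulVKg. Qed.

(** * The lower central series, tested on generators *)

Section LowerCentral.
Variable G : groupType.

Lemma lower_central_subgroup n : subgroup (lower_central G n).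
Proof.
by case: n => [|n]; [exact/subgroupP | exact: generated_subgroup_subgroup].
Qed.

Lemma lower_centralR n (x y : G) :
  lower_central G n x -> lower_central G n.+1 [~ x, y].
Proof. by move=> nx; apply: sub_generated_subgroup; exists x, y. Qed.

Lemma lower_centralS n : lower_central G n.+1 `<=` lower_central G n.
Proof.
elim: n => // n IHn; apply: generated_subgroup_min => [|_ [x [y [nx ->]]]].
  exact: lower_central_subgroup.
by apply: lower_centralR; exact: IHn.
Qed.

Lemma lower_centralJ n (x y : G) :
  lower_central G n x -> lower_central G n (x ^ y).
Proof.
move=> nx; rewrite conjg_mulR; apply: (subgroupM (lower_central_subgroup n)) => //.
by apply: lower_centralS; exact: lower_centralR.
Qed.

Lemma lower_central_normal n : is_normal (lower_central G n).
Proof. by split; [exact: lower_central_subgroup | move=> x y; exact: lower_centralJ]. Qed.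

Section Generators.
Variables (n : nat) (D : set G).
Hypotheses (sD : subgroup D) (nD : lower_central G n.+2 `<=` D).

(** Conjugation changes [x,y] only by an element of [lower_central G n.+2], which lies in [D], so
    modulo [D] the map y -> [x,y] is multiplicative. Normality of [D] is not assumed. *)
Lemma commgr_subgroup (x : G) :
  lower_central G n x -> subgroup [set y | D [~ x, y]].
Proof.
move=> nx; have DJ y z : D [~ x, y] -> D ([~ x, y] ^ z).
  move=> Dy; rewrite conjg_mulR; apply: subgroupM => //.
  by apply: nD; do 2!apply: lower_centralR.
apply/subgroupP; split=> [|y z Dy Dz] /=; first by rewrite commg1; exact: subgroup1.
rewrite commgMr commgVr conjVg; apply: subgroupM => //; last exact: DJ.
by apply: subgroupV => //; exact: DJ.
Qed.

Lemma commgl_subgroup (A : set G) :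
  subgroup [set x | lower_central G n x /\ forall c, A c -> D [~ x, c]].
Proof.
have sn := lower_central_subgroup n.
have DJ x y z : lower_central G n x -> D [~ x, y] -> D ([~ x, y] ^ z).
  move=> nx Dy; rewrite conjg_mulR; apply: subgroupM => //.
  by apply: nD; do 2!apply: lower_centralR.
apply/subgroupP; split=> [|x y [nx Dx] [ny Dy]] /=.
  by split=> [|c _]; [exact: subgroup1 | rewrite comm1g; exact: subgroup1].
split=> [|c Ac]; first exact: subgroupF.
rewrite commgMl commgVl conjVg; apply: subgroupM => //; first exact/DJ/Dx.
by apply: subgroupV => //; exact/DJ/Dy.
Qed.

(** Lets the set of [commgl_subgroup] serve in turn as the [D] of the next lower index, so that
    [lower_central_gen] can be iterated. *)
Lemma lower_central_commgl (A : set G) : lower_central G n.+1 `<=`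
  [set x | lower_central G n x /\ forall c, A c -> D [~ x, c]].
Proof.
move=> x nx; split=> [|c _]; first exact: lower_centralS.
by apply: nD; exact: lower_centralR.
Qed.

(** For fixed x the admissible second arguments form a subgroup by [commgr_subgroup], so it suffices
    to check them on [A]. *)
Lemma lower_central_gen (A : set G) : generated_subgroup A = setT ->
  lower_central G n `<=`
    [set x | lower_central G n x /\ forall c, A c -> D [~ x, c]] ->
  lower_central G n.+1 `<=` D.
Proof.
move=> genA nA; apply: generated_subgroup_min => // _ [x [y [nx ->]]].
suff: generated_subgroup A `<=` [set y | D [~ x, y]] by apply; rewrite genA.
by apply: generated_subgroup_min => [|c Ac]; [exact: commgr_subgroup | apply: (nA x nx).2].
Qed.

End Generators.
End LowerCentral.

(** * The lower central series under homomorphisms and quotients *)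

Section Functoriality.
Variables (G H : groupType) (f : UMagmaMorphism.type G H).

Lemma lower_central_morph n (x : G) :
  lower_central G n x -> lower_central H n (f x).
Proof.
elim: n x => // n IHn.
suff: lower_central G n.+1 `<=` f @^-1` lower_central H n.+1 by [].
apply: generated_subgroup_min.
  by apply: subgroup_preimage; exact: lower_central_subgroup.
by move=> _ [x [y [nx ->]]] /=; rewrite gmulfR; apply: lower_centralR; exact: IHn.
Qed.

Lemma lower_central_surj n : (forall y, exists x, f x = y) ->
  lower_central H n `<=` f @` lower_central G n.
Proof.
move=> fsurj; elim: n => [y _|n IHn]; first by have [x <-] := fsurj y; exists x.
apply: generated_subgroup_min.
  by apply: subgroup_image; exact: lower_central_subgroup.
move=> _ [_ [y' [/IHn[x nx <-] ->]]]; have [y <-] := fsurj y'.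
by exists [~ x, y]; [exact: lower_centralR | rewrite gmulfR].
Qed.

End Functoriality.

Section Projection.
Variables (G : groupType) (N : normal_subgroup G).

HB.instance Definition _ :=
  isMultiplicative.Build G (quotient_group N) (@qproj G N) (@qprojM G N).
HB.instance Definition _ :=
  Multiplicative_isUMagmaMorphism.Build G (quotient_group N) (@qproj G N) erefl.

Lemma qproj_eq1 (x : G) : (qproj N x = 1) <-> N x.
Proof.
rewrite -[1]/(qproj N 1) qproj_eq mulg1; split=> /nsetV //.
by rewrite invgK.
Qed.

Lemma qproj_surj (y : quotient_group N) : exists x, qproj N x = y.
Proof. by exists (repr y); exact: qprojK. Qed.

End Projection.

Definition lower_central_nsub (G : groupType) (n : nat) : normal_subgroup G :=
  NormalSubgroup (@lower_central_normal G n).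

Lemma lower_central_quotient (G : groupType) (n : nat) :
  lower_central (quotient_group (lower_central_nsub G n)) n = [set 1].
Proof.
apply/seteqP; split=> [z|_ ->]; last exact: (subgroup1 (lower_central_subgroup _ _)).
move=> /(lower_central_surj (@qproj_surj _ _))[x nx <-].
exact/qproj_eq1.
Qed.

(** * Exponents of successive lower central factors *)

Section CentralTerm.
Variables (G : groupType) (n : nat).
Hypothesis G1 : lower_central G n.+1 = [set 1].

Lemma lower_central_central (x y : G) : lower_central G n x -> commute x y.
Proof.
move=> nx; apply/commgP/eqP; have := lower_centralR y nx.
by rewrite G1.
Qed.

Lemma lower_central_expg_subgroup m :
  subgroup [set x | lower_central G n x /\ x ^+ m = 1].
Proof.
apply/subgroupP; split=> [|x y [nx xm] [ny ym]] /=.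
  by split; [exact: (subgroup1 (lower_central_subgroup _ _)) | rewrite expg1n].
split; first exact: (subgroupF (lower_central_subgroup G n)).
by rewrite expgnFl ?xm ?ym ?divg1 //; exact: lower_central_central.
Qed.

End CentralTerm.

Lemma commXg (G : groupType) (x y : G) n :
  commute x [~ x, y] -> [~ x ^+ n, y] = [~ x, y] ^+ n.
Proof.
move=> cx; elim: n => [|n IHn]; first by rewrite comm1g.
rewrite !expgS commgMl IHn; congr (_ * _).
by apply/conjg_fixP/commgP/commuteX/commute_sym.
Qed.

(** Modulo [lower_central G n.+2] the commutator [x,y] is central, so [x,y]^m = [x^m,y], and this
    vanishes because x^m already lies one term further down. *)
Lemma lower_central_expg_step (G : groupType) (n m : nat) :
  (forall x, lower_central G n x -> lower_central G n.+1 (x ^+ m)) ->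
  forall x, lower_central G n.+1 x -> lower_central G n.+2 (x ^+ m).
Proof.
move=> nm x nx; pose N := lower_central_nsub G n.+2.
have Q1 : lower_central (quotient_group N) n.+2 = [set 1].
  exact: lower_central_quotient.
apply/(qproj_eq1 N); rewrite gmulfXn; move: x nx.
suff: lower_central G n.+1 `<=` qproj N @^-1`
    [set x | lower_central (quotient_group N) n.+1 x /\ x ^+ m = 1].
  by move=> nN x /nN[].
apply: generated_subgroup_min => [|_ [x [y [nx ->]]]].
  exact/subgroup_preimage/lower_central_expg_subgroup.
have nxy := lower_centralR y nx; split; first exact: lower_central_morph.
rewrite gmulfR -commXg; last first.
  apply: commute_sym; apply: lower_central_central Q1 _ _ _.
  by rewrite -gmulfR; exact: lower_central_morph.
rewrite -gmulfXn -gmulfR; apply/(qproj_eq1 N).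
by apply: lower_centralR; exact: nm.
Qed.

(** * Groups of nilpotency class at most four *)

Section ClassFour.
Variable G : groupType.
Hypothesis G4 : lower_central G 4 = [set 1].

Lemma class4_central (x y : G) : lower_central G 3 x -> commute x y.
Proof. exact: lower_central_central. Qed.

Lemma class4_commg_central (x y z : G) : lower_central G 2 x -> commute [~ x, y] z.
Proof. by move=> nx; apply: class4_central; exact: lower_centralR. Qed.

Lemma class4_commMgl (x y z : G) : lower_central G 2 x ->
  [~ x * y, z] = [~ x, z] * [~ y, z].
Proof.
move=> nx; rewrite commgMl; congr (_ * _).
by apply/conjg_fixP/commgP; exact: class4_commg_central.
Qed.

Lemma class4_commMgr (x y z : G) : lower_central G 2 x ->
  [~ x, y * z] = [~ x, y] * [~ x, z].
Proof.
move=> nx; rewrite commgMr (conjg_fixP _); last first.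
  by apply/commgP; exact: class4_commg_central.
by apply: commute_sym; exact: class4_commg_central.
Qed.

Lemma class4_commVgl (x y : G) : lower_central G 2 x -> [~ x^-1, y] = [~ x, y]^-1.
Proof.
move=> nx; apply/esym/mulg1_eq; rewrite -class4_commMgl // mulgV; exact: comm1g.
Qed.

Lemma class4_commVgr (x y : G) : lower_central G 2 x -> [~ x, y^-1] = [~ x, y]^-1.
Proof.
move=> nx; apply/esym/mulg1_eq; rewrite -class4_commMgr // mulgV; exact: commg1.
Qed.

Lemma class4_commJg (x y z : G) : lower_central G 2 x -> [~ x ^ y, z] = [~ x, z].
Proof.
move=> nx; rewrite conjg_mulR class4_commMgl //; set w := [~ [~ x, y], z].
suff -> : w = 1 by rewrite mulg1.
by apply/eqP/commgP; exact: class4_commg_central.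
Qed.

(** An instance of [gamma_3, gamma_2] <= gamma_5. For x in gamma_3 the map [x,-] is a homomorphism
    with central values, hence kills commutators. *)
Lemma class4_commute (x y : G) : lower_central G 2 x -> lower_central G 1 y ->
  commute x y.
Proof.
move=> nx; move: y; suff: lower_central G 1 `<=` [set y | [~ x, y] = 1].
  by move=> h y /h /eqP /commgP.
apply: generated_subgroup_min => [|_ [y [z [_ ->]]]] /=.
  have := @commgr_subgroup G 2 [set 1].
  by apply=> //; [apply/subgroupP; split=> // ? ? -> ->; rewrite divg1 | rewrite G4].
have zc : commute [~ x, y] [~ x, z] by exact: class4_commg_central.
rewrite [X in [~ x, X]]commgEl conjgE !class4_commMgr // !class4_commVgr //.
by rewrite zc mulKg mulVg.
Qed.

Section Generated.
Variables a b : G.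
Hypothesis genG : generated_subgroup [set a; b] = setT.
Let u := [~ b, a].
Hypothesis Ra : [~ u, a, a] = 1.
Hypothesis Rba : [~ u, b * a, b * a] = 1.
Hypothesis RVba : [~ u, b^-1 * a, b^-1 * a] = 1.

Let p := [~ u, a].
Let q := [~ u, b].

Let u1 : lower_central G 1 u. Proof. exact: lower_centralR. Qed.
Let p2 : lower_central G 2 p. Proof. exact: lower_centralR. Qed.
Let q2 : lower_central G 2 q. Proof. exact: lower_centralR. Qed.

(* The group form of [[u,a],b] - [[u,b],a] = [u,[a,b]], where [a,b] = - u. *)
Lemma class4_Jacobi : [~ p, b] = [~ q, a].
Proof.
have pq : commute p q.
  by apply: class4_commute => //; exact: lower_centralS.
(* The products ab and ba differ by the factor u^-1, and u commutes with [u,ba]. *)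
have baV : [~ u, a * b] = [~ u, b * a].
  have -> : a * b = b * a * u^-1 by rewrite invgR -commgC.
  rewrite commgMr commgVg mul1g; apply/conjg_fixP/commgP/commuteV.
  by apply: class4_commute => //; exact: lower_centralR.
(* Expanding both sides gives q p [p,b] = p q [q,a], where p and q commute. *)
move: baV; rewrite !commgMr -/p -/q !conjg_mulR (mulgA q) (mulgA p) pq.
exact: mulgI.
Qed.

(** With s = [p,b], the four commutators are [p,a] = 1, [p,b] = [q,a] = s and [q,b] = s^-2, so
    everything reduces to s^4 = 1. *)
Lemma class4_generator_expg4 (x y : G) :
  [\/ x = p | x = q] -> [\/ y = a | y = b] -> [~ x, y] ^+ 4 = 1.
Proof.
pose s := [~ p, b].
have ps z : commute s z by exact: class4_commg_central.
(* The two relations [Rba] and [RVba] read s^2 [q,b] = 1 and s^-2 [q,b] = 1. *)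
have pq_b : s ^+ 2 * [~ q, b] = 1.
  move: Rba; rewrite (commgMr u) -/p -/q class4_commMgl //.
  rewrite class4_commJg // !class4_commMgr //.
  rewrite -class4_Jacobi -/s Ra mulg1 -(ps [~ q, b]).
  by rewrite mulgA.
have pqV_b : s ^- 2 * [~ q, b] = 1.
  move: RVba; rewrite (commgMr u) (commgVr u) -/p -/q class4_commMgl //.
  rewrite !class4_commJg //; last first.
  - by apply: lower_centralJ; exact: (subgroupV (lower_central_subgroup G 2)).
  - exact: (subgroupV (lower_central_subgroup G 2)).
  rewrite class4_commVgl // !class4_commMgr // !class4_commVgr //.
  rewrite -class4_Jacobi -/s Ra mulg1.
  by rewrite (invgM _ s) invgK mulgA -invgM.
have s4 : s ^+ 4 = 1.
  rewrite -[4]/(2 + 2)%N expgnDr; apply/eqP; rewrite mulg_eq1; apply/eqP.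
  by apply: (mulIg [~ q, b]); rewrite pq_b pqV_b.
have qb : [~ q, b] = s ^- 2 by apply/esym/mulg1_eq.
case=> -> [] ->; rewrite -?class4_Jacobi ?Ra ?expg1n //.
by rewrite qb expVgn -expgnA (expgnA s 4 2) s4 expg1n invg1.
Qed.

Lemma class4_expg4 x : lower_central G 3 x -> x ^+ 4 = 1.
Proof.
pose T n (D : set G) :=
  [set x | lower_central G n x /\ forall c, [set a; b] c -> D [~ x, c]].
pose D3 := [set x | lower_central G 3 x /\ x ^+ 4 = 1].
have sD3 : subgroup D3 by exact: lower_central_expg_subgroup.
have nD3 : lower_central G 4 `<=` D3.
  by rewrite G4 => _ ->; exact: (subgroup1 sD3).
have sD2 := commgl_subgroup sD3 nD3 [set a; b].
have nD2 := lower_central_commgl nD3 [set a; b].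
have sD1 := commgl_subgroup sD2 nD2 [set a; b].
have nD1 := lower_central_commgl nD2 [set a; b].
have sD0 := commgl_subgroup sD1 nD1 [set a; b].
suff: lower_central G 3 `<=` D3 by move=> h /h[].
(* Three descents replace [lower_central G 3] by G itself; the condition then concerns only
   [y,c,d,e] with c, d, e among the generators, and [sD0] lets y be a generator too. *)
apply: (lower_central_gen sD3 nD3 genG); apply: (lower_central_gen sD2 nD2 genG).
apply: (lower_central_gen sD1 nD1 genG) => y _.
have: generated_subgroup [set a; b] y by rewrite genG.
apply: generated_subgroup_min y => // y ab; split=> // c Ac.
have Du : T 1%N (T 2%N D3) u.
  split=> // z Az; split; first exact: lower_centralR.
  move=> w Aw; split; first by do 2!apply: lower_centralR.
  apply: class4_generator_expg4; last by case: Aw; [left | right].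
  by case: Az => ->; [left | right].
(* The brackets of two generators are 1, u and u^-1, so [Du] is enough. *)
case: ab => ->; case: Ac => ->; rewrite ?commgg //; first exact: (subgroup1 sD1).
  by rewrite -invgR; exact: (subgroupV sD1).
exact: (subgroup1 sD1).
Qed.

End Generated.
End ClassFour.

(** * Two-generated torsion-free nilpotent groups *)

Lemma generated_subgroup_surj (G H : groupType) (f : UMagmaMorphism.type G H)
    (A : set G) : (forall y, exists x, f x = y) ->
  generated_subgroup A = setT -> generated_subgroup (f @` A) = setT.
Proof.
move=> fsurj genG; apply/seteqP; split=> // y _; have [x <-] := fsurj y.
have: generated_subgroup A x by rewrite genG.
suff: generated_subgroup A `<=` f @^-1` generated_subgroup (f @` A).
  by move=> h /h.
apply: generated_subgroup_min.
  by apply: subgroup_preimage; exact: generated_subgroup_subgroup.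
by move=> c Ac; apply: sub_generated_subgroup; exists c.
Qed.

Section TorsionFreeNilpotent.
Variables (G : groupType) (a b : G).
Hypothesis genG : generated_subgroup [set a; b] = setT.
Let u := [~ b, a].
Hypothesis Ra : [~ u, a, a] = 1.
Hypothesis Rba : [~ u, b * a, b * a] = 1.
Hypothesis RVba : [~ u, b^-1 * a, b^-1 * a] = 1.

(** The base case is [class4_expg4] in the quotient by [lower_central G 4];
    [lower_central_expg_step] carries the exponent 4 down the series. *)
Lemma lower_central_expg4 n x :
  lower_central G (n + 3) x -> lower_central G (n + 3).+1 (x ^+ 4).
Proof.
elim: n x => [|n IHn] x; last by rewrite !addSn; exact: lower_central_expg_step.
move=> nx; apply/(qproj_eq1 (lower_central_nsub G 4)); rewrite gmulfXn.
have genQ := generated_subgroup_surj (@qproj_surj _ (lower_central_nsub G 4)) genG.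
rewrite image_setU !image_set1 in genQ.
apply: class4_expg4 genQ _ _ _ _ _; first exact: lower_central_quotient.
- by rewrite -!gmulfR Ra gmulf1.
- have := congr1 (qproj (lower_central_nsub G 4)) Rba.
  by rewrite !gmulfR gmulfM gmulf1.
- have := congr1 (qproj (lower_central_nsub G 4)) RVba.
  by rewrite !gmulfR gmulfM gmulfV gmulf1.
- exact: lower_central_morph.
Qed.

Lemma lower_central3_eq1 : torsion_free G -> is_nilpotent G ->
  forall x, lower_central G 3 x -> x = 1.
Proof.
move=> tf [n Gn].
(* Starting from a trivial term, the series is climbed: x^4 lies in a trivial term, so x = 1. The
   shift by 3 makes the climb end exactly at [lower_central G 3]. *)
have: lower_central G (n + 3) `<=` [set 1].
  rewrite -Gn addnC; elim: 3 => // k IHk x.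
  by rewrite addSn => /lower_centralS /IHk.
elim: n {Gn} => // n IHn nG; apply: IHn => x /lower_central_expg4.
move=> /nG; exact: tf.
Qed.

End TorsionFreeNilpotent.

(** * A generated subgroup as a group in its own right *)

Section GeneratedType.
Variables (G : groupType) (A : set G).

(** [lower_central] takes a group type as argument, so the subgroup H generated by a and b needs a
    type of its own. *)
Record generated_type : Type :=
  GeneratedType { gtval : G; _ : gtval \in generated_subgroup A }.

HB.instance Definition _ := [isSub for gtval].
HB.instance Definition _ := [Choice of generated_type by <:].
HB.instance Definition _ := SubChoice_isSubGroup.Build _ _ generated_type
  (generated_subgroup_subgroup A).

Definition gtgen (x : G) (Ax : A x) : generated_type :=
  GeneratedType (mem_set (sub_generated_subgroup Ax)).

End GeneratedType.

Lemma generated_type_gen (G : groupType) (A : set G) :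
  generated_subgroup (val @^-1` A) = [set: generated_type A].
Proof.
apply/seteqP; split=> // -[x xA] _ M [sM AM].
have: generated_subgroup A x by rewrite inE in xA.
have sM' : subgroup [set val y | y in M] by exact: subgroup_image.
suff: generated_subgroup A `<=` [set val y | y in M].
  move=> h /h[y My yx]; suff -> : GeneratedType xA = y by [].
  exact: val_inj.
apply: generated_subgroup_min => // y Ay.
by exists (gtgen Ay) => //; exact: AM.
Qed.

(** Torsion-freeness and nilpotence pass to the subgroup H generated by a and b, and [u,a,b] lies in
    the fourth term gamma_4(H). *)
Lemma two_generated_lower_central3_eq1 (G : groupType) (a b : G) :
  torsion_free G -> is_nilpotent G ->
  let u := [~ b, a] in
  [~ u, a, a] = 1 -> [~ u, b * a, b * a] = 1 ->
  [~ u, b^-1 * a, b^-1 * a] = 1 -> [~ u, a, b] = 1.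
Proof.
move=> tf [n Gn] u Ra Rba RVba; pose K := generated_type [set a; b].
pose a' : K := gtgen (or_introl erefl : [set a; b] a).
pose b' : K := gtgen (or_intror erefl : [set a; b] b).
have genK : generated_subgroup [set a'; b'] = setT.
  rewrite -generated_type_gen; congr generated_subgroup.
  apply/seteqP; split=> [_ [] ->|x [] xE]; [by left|by right|left|right];
    exact: val_inj.
pose u' := [~ b', a'].
have uE : val [~ u', a', b'] = [~ u, a, b] by rewrite !gmulfR.
rewrite -uE; suff -> : [~ u', a', b'] = 1 by rewrite gmulf1.
apply: (lower_central3_eq1 genK).
- by apply: val_inj; rewrite !gmulfR gmulf1.
- by apply: val_inj; rewrite !gmulfR gmulfM gmulf1.
- by apply: val_inj; rewrite !gmulfR gmulfM gmulfV gmulf1.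
- move=> x m m0 xm; apply: val_inj; rewrite gmulf1; apply: (tf _ m) => //.
  by rewrite -gmulfXn xm gmulf1.
- exists n; apply/seteqP; split=> [x nx|_ ->].
    apply: val_inj; rewrite gmulf1; have := lower_central_morph val nx.
    by rewrite Gn.
  exact: (subgroup1 (lower_central_subgroup _ _)).
- by do 3!apply: lower_centralR.
Qed.

(** * Consequences of the two relators *)

(** Conjugation by c^-1 turns ac into ca. As b commutes with c, [b,ac] = [b,a]^c, so the innermost
    bracket becomes u. *)
Lemma engel_conj (G : groupType) (a b c : G) : commute b c ->
  [~ b, a * c, a * c, a * c] = 1 ->
  let u := [~ b, a] in [~ u, c * a, c * a] = 1.
Proof.
move=> bc /(congr1 (conjg^~ c^-1)); rewrite conj1g /= !conjRg.
have -> : [~ b ^ c^-1, (a * c) ^ c^-1] = [~ b, a].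
  by rewrite -conjRg commgMr (eqP (introT commgP bc)) mul1g conjgK.
have -> : (a * c) ^ c^-1 = c * a by rewrite /conjg !gnorm.
by [].
Qed.

Lemma engel_relations (G : groupType) (a t : G) :
  [~ a, t, t] = 1 -> [~ a, t, a, a, a] = 1 ->
  let b := [~ a, t] in let u := [~ b, a] in
  [/\ [~ u, a, a] = 1, [~ u, b * a, b * a] = 1 & [~ u, b^-1 * a, b^-1 * a] = 1].
Proof.
move=> Rt Ra b u; have bt : b ^ t = b by apply/conjg_fixP/eqP.
have at1 : a ^ t = a * b by rewrite conjg_mulR.
have bV : b ^ t^-1 = b by rewrite -{1}bt conjgK.
have aV : a ^ t^-1 = a * b^-1.
  by apply: (conjg_inj t); rewrite conjgKV conjMg conjVg bt at1 mulgK.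
split=> //; apply: engel_conj.
- by [].
(* This is the second relator conjugated by t, which fixes b and sends a to ab; the last case uses
   t^-1. *)
- by rewrite -at1 -{1}bt -!conjRg Ra conj1g.
- exact: commuteV.
- by rewrite -aV -{1}bV -!conjRg Ra conj1g.
Qed.

(** * Evaluation of free group words *)

Section FreeGroupEval.
Variables (X : choiceType) (G : groupType) (v : X -> G).

Definition letter_eval (l : X * bool) : G := if l.2 then (v l.1)^-1 else v l.1.

Definition word_eval (w : seq (X * bool)) : G := \prod_(l <- w) letter_eval l.

Lemma letter_eval_linv l : letter_eval (linv l) = (letter_eval l)^-1.
Proof. by case: l => x [] //=; rewrite invgK. Qed.

Lemma word_eval_push l w : word_eval (push l w) = letter_eval l * word_eval w.
Proof.
rewrite /word_eval; case: w => [|k w] /=; first by rewrite big_seq1 big_nil mulg1.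
case: eqP => [->|_]; last by rewrite big_cons.
by rewrite big_cons letter_eval_linv mulVKg.
Qed.

Lemma word_eval_reduce w : word_eval (reduce w) = word_eval w.
Proof.
elim: w => //= l w IHw; rewrite word_eval_push IHw.
by rewrite [RHS]big_cons.
Qed.

Definition fgeval (w : freegroup X) : G := word_eval w.

Lemma fgevalM : {morph fgeval : u w / u * w}.
Proof. by move=> u w; rewrite /fgeval word_eval_reduce /word_eval big_cat. Qed.

Lemma fgeval1 : fgeval 1 = 1.
Proof. by rewrite /fgeval /word_eval big_nil. Qed.

HB.instance Definition _ := isMultiplicative.Build (freegroup X) G fgeval fgevalM.
HB.instance Definition _ :=
  Multiplicative_isUMagmaMorphism.Build (freegroup X) G fgeval fgeval1.

Lemma fgeval_gen x : fgeval (fggen x) = v x.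
Proof. by rewrite /fgeval /word_eval big_seq1. Qed.

(** The kernel of the evaluation is a normal subgroup containing [R]. *)
Lemma fgeval_normal_closure (R : set (freegroup X)) :
  (forall r, R r -> fgeval r = 1) ->
  forall w, normal_closure R w -> fgeval w = 1.
Proof.
move=> R1 w nw; apply: (nw (fgeval @^-1` [set 1])); split=> //; split.
  apply: subgroup_preimage.
  by apply/subgroupP; split=> // _ _ -> ->; rewrite divg1.
move=> x y /= x1; by rewrite gmulfJ /= x1 conj1g.
Qed.

End FreeGroupEval.

(** * The permutation representation *)

(** Reads a commutator off qp = pq[q,p], so that no inverse permutation has to be computed. *)
Lemma perm_commE (T : finType) (p q : {perm T}) (f : T -> T) :
  (forall s, f (q (p s)) = p (q s)) -> forall s, [~ q, p] s = f s.
Proof.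
move=> pq s; have := commgC q p; move: [~ q, p] => c qp.
have /permP/(_ (p^-1 (q^-1 s))) := qp.
by rewrite !permM -pq !permKV.
Qed.

Lemma perm_comm1 (T : finType) (p q : {perm T}) :
  (forall s, q (p s) = p (q s)) -> [~ p, q] = 1.
Proof.
move=> pq; apply/eqP/commgP/permP => s; by rewrite !permM.
Qed.

(* Row vectors (1, x, y, z, w) over F_2 together with a residue k mod 4 with
   binary digits i (units) and j. With A = I + e12 + e23 and B = I + e34 + e45,
   [wit_a] multiplies by A B^k in the layer k, and [wit_t] moves the layer k to
   k - 1; then [wit_a, wit_t] is multiplication by B in every layer. *)
Definition wit_point : finType := (bool * bool * bool * bool * bool * bool)%type.

(** Over F_2, B^k = I + k(e34 + e45) + C(k,2) e35, where i and j are the parities of k and C(k,2);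
    hence B^4 = I and k matters only mod 4. *)
Definition wit_a_fun (s : wit_point) : wit_point :=
  let: (x, y, z, w, i, j) := s in
  let y' := y (+) x in
  (~~ x, y', z (+) (i && y'), w (+) (i && z) (+) (j && y'), i, j).

Definition wit_a_inv (s : wit_point) : wit_point :=
  let: (x, y, z, w, i, j) := s in
  let z' := z (+) (i && y) in
  (~~ x, y (+) ~~ x, z', w (+) (i && z') (+) (j && y), i, j).

Definition wit_t_fun (s : wit_point) : wit_point :=
  let: (x, y, z, w, i, j) := s in (x, y, z, w, ~~ i, j (+) ~~ i).

Definition wit_t_inv (s : wit_point) : wit_point :=
  let: (x, y, z, w, i, j) := s in (x, y, z, w, ~~ i, j (+) i).

Lemma wit_aK : cancel wit_a_fun wit_a_inv.
Proof. by move=> [[[[[[] []] []] []] []] []]. Qed.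

Lemma wit_tK : cancel wit_t_fun wit_t_inv.
Proof. by move=> [[[[[[] []] []] []] []] []]. Qed.

Definition wit_a : {perm wit_point} := perm (can_inj wit_aK).
Definition wit_t : {perm wit_point} := perm (can_inj wit_tK).

Definition wit_b_fun (s : wit_point) : wit_point :=
  let: (x, y, z, w, i, j) := s in (x, y, z (+) y, w (+) z, i, j).

(** In the layer k this is the matrix I + e14 + e24 + k(e15 + e25); [wit_p_fun] is I + e14 + k(e15 +
    e25). *)
Definition wit_u_fun (s : wit_point) : wit_point :=
  let: (x, y, z, w, i, j) := s in
  (x, y, z (+) ~~ x, w (+) (i && ~~ x), i, j).

Definition wit_p_fun (s : wit_point) : wit_point :=
  let: (x, y, z, w, i, j) := s in (x, y, ~~ z, w (+) (i && ~~ x), i, j).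

Definition wit_b := [~ wit_a, wit_t].
Definition wit_u := [~ wit_b, wit_a].
Definition wit_p := [~ wit_u, wit_a].

Lemma wit_bE s : wit_b s = wit_b_fun s.
Proof.
by apply: perm_commE => {}s; rewrite !permE;
  move: s => [[[[[[] []] []] []] []] []].
Qed.

Lemma wit_uE s : wit_u s = wit_u_fun s.
Proof.
by apply: perm_commE => {}s; rewrite !(permE, wit_bE);
  move: s => [[[[[[] []] []] []] []] []].
Qed.

Lemma wit_pE s : wit_p s = wit_p_fun s.
Proof.
by apply: perm_commE => {}s; rewrite !(permE, wit_uE);
  move: s => [[[[[[] []] []] []] []] []].
Qed.

Lemma wit_bt : [~ wit_b, wit_t] = 1.
Proof.
by apply: perm_comm1 => s; rewrite !(permE, wit_bE);
  move: s => [[[[[[] []] []] []] []] []].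
Qed.

Lemma wit_pa : [~ wit_p, wit_a] = 1.
Proof.
by apply: perm_comm1 => s; rewrite !(permE, wit_pE);
  move: s => [[[[[[] []] []] []] []] []].
Qed.

Lemma wit_pb : [~ wit_p, wit_b] <> 1.
Proof.
move=> /eqP /commgP pb.
(* The two products differ by e15, that is, in w; the zero point already shows it. *)
have /permP/(_ (false, false, false, false, false, false)) := pb.
by rewrite (permM wit_p wit_b) (permM wit_b wit_p) !(wit_pE, wit_bE).
Qed.

(* The two generators are indexed by bool: a is [fggen true], t is [fggen false]. *)
Theorem theorem7 :
  let a : freegroup bool := fggen true in
  let t : freegroup bool := fggen false in
  ~ residually_torsion_free_nilpotent
      (presented [set [~ a, t, t]; [~ a, t, a, a, a]]).
Proof.
move=> a t; set R := [set _; _] => rtfn.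
pose G := presented R.
pose pa : G := qproj _ a; pose pt : G := qproj _ t.
have rel r : R r -> qproj (normal_closure R) r = 1.
  by move=> Rr; apply/qproj_eq1 => M [_]; apply.
have Rt : [~ pa, pt, pt] = 1.
  by have := rel _ (or_introl erefl); rewrite !gmulfR.
have Ra : [~ pa, pt, pa, pa, pa] = 1.
  by have := rel _ (or_intror erefl); rewrite !gmulfR.
(* The element [b,a,a,b] with b = [a,t]. *)
pose g : G := [~ [~ pa, pt], pa, pa, [~ pa, pt]].
have g1 : g <> 1.
  have -> : g = qproj _ [~ [~ a, t], a, a, [~ a, t]] by rewrite !gmulfR.
  (* If g were trivial, its lift would lie in the normal closure of the relators, and the evaluation
     at the two permutations would give [[~ wit_p, wit_b] = 1]. *)
  move/qproj_eq1; pose v x := if x then wit_a else wit_t.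
  have aE : fgeval v a = wit_a by exact: fgeval_gen.
  have tE : fgeval v t = wit_t by exact: fgeval_gen.
  move=> /(@fgeval_normal_closure _ _ v); rewrite !gmulfR /= aE tE.
  move=> h; apply: wit_pb; apply: h.
  by move=> _ [] ->; rewrite !gmulfR /= aE tE; [exact: wit_bt | exact: wit_pa].
(* Both relations survive modulo N, which forces g into N. *)
have [N [Ng tf nil]] := rtfn g g1; apply: Ng; apply/qproj_eq1.
rewrite /g !gmulfR.
have [||R1 R2 R3] := @engel_relations _ (qproj N pa) (qproj N pt).
- by have := congr1 (qproj N) Rt; rewrite !gmulfR gmulf1.
- by have := congr1 (qproj N) Ra; rewrite !gmulfR gmulf1.
exact: two_generated_lower_central3_eq1 tf nil R1 R2 R3.
Qed.
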